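(* Let $C=2.46\cdot 10^{-4}$. For every $n\ge 1$, every compact convex body $X\subseteq\mathbb{R}^n$ containing the origin, every $\sigma>0$ and every $0<c_*\le 1$, $$R(X,\sigma)\ \ge\ C\,c_*^2\,\max_{1\le k\le n}\ \min\{\,z_{c_*,k}(X)^2,\ k\sigma^2\,\}.$$
   Context: Minimax risk. An unknown vector $x\in X\subseteq\mathbb{R}^n$ is observed through $y=x+w$ with $w\sim \mathsf{N}(0,\sigma^2 I)$ in $\mathbb{R}^n$. Then $R(X,\sigma)=\inf_{M}\sup_{x\in X}\mathbb{E}\|x-M(y)\|^2$, the infimum over all (possibly nonlinear, measurable) estimators $M:\mathbb{R}^n\to\mathbb{R}^n$, where $\|\cdot\|$ is the Euclidean norm. Volume ratio and approximation radius. Let $B_2^k(r)$ be the closed Euclidean ball of radius $r$ centered at the origin in a $k$-dimensional space. For a $k$-dimensional linear subspace $H\subseteq\mathbb{R}^n$ and $r>0$, $$\mathrm{vr}(X\cap H,r)=\left(\frac{\mathrm{vol}_k\big(X\cap H\cap B_2^n(r)\big)}{\mathrm{vol}_k\big(B_2^k(r)\big)}\right)^{1/k},$$ where $\mathrm{vol}_k$ is $k$-dimensional Lebesgue measure (in $H$, respectively in $\mathbb{R}^k$). The $k$-volume ratio is $\mathrm{vr}_k(X,r)=\max_{H}\mathrm{vr}(X\cap H,r)$, the maximum over all $k$-dimensional linear subspaces $H$ of $\mathbb{R}^n$. For $0\le c\le 1$ and an integer $1\le k\le n$, the $(c,k)$-approximation radius of $X$ is $$z_{c,k}(X)=\sup\{r>0:\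 \mathrm{vr}_k(X,r)\ge c\},$$ with the convention $\sup\emptyset=0$. *)

(* Defs.v *)
From HB Require Import structures.
From mathcomp Require Import all_boot all_order all_algebra.
From mathcomp Require Import all_classical all_reals all_analysis.

Set Implicit Arguments.
Unset Strict Implicit.
Unset Printing Implicit Defensive.

Import Order.TTheory GRing.Theory Num.Theory.
Import numFieldNormedType.Exports.

Local Open Scope classical_set_scope.
Local Open Scope ring_scope.

(* The sigma-algebra on R^n generated by the coordinates, i.e. the product
   (equivalently, since R is second countable, the Borel) sigma-algebra;
   same construction as the library's instance on n.-tuple T. *)
Definition measure_row_display : measure_display.
Proof. exact: default_measure_display. Qed.

Section measurable_row.
Variables (R : realType) (n : nat).

Let coors (i : 'I_n) (x : 'rV[R]_n) : measurableTypeR R := x ord0 i.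

Let row_set0 : g_sigma_preimage coors set0.
Proof. exact: sigma_algebra0. Qed.

Let row_setC A : g_sigma_preimage coors A -> g_sigma_preimage coors (~` A).
Proof. exact: sigma_algebraC. Qed.

Let row_bigcup (F : (set 'rV[R]_n)^nat) :
  (forall i, g_sigma_preimage coors (F i)) ->
  g_sigma_preimage coors (\bigcup_i (F i)).
Proof. exact: sigma_algebra_bigcup. Qed.

HB.instance Definition _ := @isMeasurable.Build
  measure_row_display 'rV[R]_n
  (g_sigma_preimage coors) row_set0 row_setC row_bigcup.

Lemma measurable_coord (i : 'I_n) :
  measurable_fun [set: 'rV[R]_n]
    (fun x : 'rV[R]_n => x ord0 i : measurableTypeR R).
Proof.
move=> _ Y mY; rewrite setTI; apply: sub_sigma_algebra => /=.
rewrite -bigcup_seq/=; exists i => /=; first by rewrite mem_index_enum.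
by exists Y => //; rewrite setTI.
Qed.

Lemma measurable_fun_rowP d (T : measurableType d) (f : T -> 'rV[R]_n) :
  measurable_fun [set: T] f <->
  forall i, measurable_fun [set: T] (fun t => f t ord0 i : measurableTypeR R).
Proof.
split=> [mf i|mf].
  exact: (measurableT_comp (measurable_coord i) mf).
move=> _ A mA; rewrite setTI.
suff : g_sigma_preimage coors `<=` [set B | measurable (f @^-1` B)] by exact.
apply: smallest_sub.
  split => //=.
  - by rewrite preimage_set0; exact: measurable0.
  - by move=> B /= mB; rewrite setTD preimage_setC; exact: measurableC.
  - by move=> F mF /=; rewrite preimage_bigcup; exact: bigcupT_measurable.
rewrite -bigcup_seq => B [i _ [C mC <-]] /=; rewrite setTI.
by have := mf i measurableT C mC; rewrite setTI.
Qed.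

End measurable_row.

Section row_cons.
Variables (R : realType) (n : nat).

Definition row_cons (p : measurableTypeR R * 'rV[R]_n) : 'rV[R]_n.+1 :=
  (row_mx (const_mx p.1) p.2 : 'rV[R]_(1 + n)).

Definition row_uncons (x : 'rV[R]_n.+1) : measurableTypeR R * 'rV[R]_n :=
  (x ord0 ord0, rsubmx (x : 'rV[R]_(1 + n))).

Lemma row_cons0 p : row_cons p ord0 ord0 = p.1.
Proof.
have -> : @ord0 n = lshift n (@ord0 0) by exact: val_inj.
by rewrite [LHS](row_mxEl (const_mx p.1) p.2) mxE.
Qed.

Lemma row_consS p i : row_cons p ord0 (lift ord0 i) = p.2 ord0 i.
Proof.
have -> : lift ord0 i = rshift 1 i by exact: val_inj.
exact: (row_mxEr (const_mx p.1) p.2).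
Qed.

Lemma row_consK : cancel row_cons row_uncons.
Proof.
move=> p; rewrite /row_uncons row_cons0 /row_cons row_mxKr.
by case: p.
Qed.

Lemma measurable_row_cons : measurable_fun [set: _] row_cons.
Proof.
apply/measurable_fun_rowP => i.
case: (unliftP ord0 i) => [j ->|->].
  under eq_fun do rewrite row_consS.
  exact: (measurableT_comp (measurable_coord j) measurable_snd).
under eq_fun do rewrite row_cons0.
exact: measurable_fst.
Qed.

Lemma measurable_row_uncons : measurable_fun [set: _] row_uncons.
Proof.
apply/measurable_fun_pairP; split; first exact: measurable_coord.
apply/measurable_fun_rowP => i.
rewrite [X in measurable_fun _ X](_ : _ =
  (fun x : 'rV[R]_n.+1 => x ord0 (rshift 1 i) : measurableTypeR R)).
  exact: (@measurable_coord R n.+1 (rshift 1 i)).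
by apply/funext => x /=; rewrite mxE.
Qed.

End row_cons.

Section product_step.
Variables (R : realType) (n : nat).
Variable mu : {sigma_finite_measure set (measurableTypeR R) -> \bar R}.
Variable nu : {sigma_finite_measure set 'rV[R]_n -> \bar R}.

Definition row_product : set 'rV[R]_n.+1 -> \bar R :=
  pushforward (mu \x nu)%E (@row_cons R n).

Let row_product0 : row_product set0 = 0%E.
Proof. by rewrite /row_product /pushforward preimage_set0 measure0. Qed.

Let row_product_ge0 A : (0 <= row_product A)%E.
Proof. exact: (measure_ge0 (mu \x nu)%E). Qed.

Let row_product_sigma_additive : semi_sigma_additive row_product.
Proof.
move=> F mF tF mUF; rewrite /row_product /pushforward preimage_bigcup.
have mpre A : measurable A -> measurable (@row_cons R n @^-1` A).
  by move=> mA; rewrite -[X in measurable X]setTI; exact: measurable_row_cons.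
apply: (@measure_semi_sigma_additive _ _ _ (mu \x nu)%E) => [i||].
- exact: mpre.
- apply/trivIsetP => /= i j _ _ ij; rewrite -preimage_setI.
  by move/trivIsetP : tF => /(_ _ _ _ _ ij) ->//; rewrite preimage_set0.
- by rewrite -preimage_bigcup; exact: mpre.
Qed.

HB.instance Definition _ := isMeasure.Build _ _ _ row_product
  row_product0 row_product_ge0 row_product_sigma_additive.

Let row_product_sigma_finite : sigma_finite setT row_product.
Proof.
have /sigma_finiteP[F [FT ndF Foo]] := sigma_finiteT mu.
have /sigma_finiteP[G [GT ndG Goo]] := sigma_finiteT nu.
exists (fun k => @row_uncons R n @^-1` (F k `*` G k)).
  apply/seteqP; split => // x _.
  have [i _ Fi] : (\bigcup_k F k) (row_uncons x).1 by rewrite -FT.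
  have [j _ Gj] : (\bigcup_k G k) (row_uncons x).2 by rewrite -GT.
  exists (maxn i j) => //; split.
    by move: Fi; exact/subsetPset/ndF/leq_maxl.
  by move: Gj; exact/subsetPset/ndG/leq_maxr.
move=> k; have [mF Fk] := Foo k; have [mG Gk] := Goo k; split.
  rewrite -[X in measurable X]setTI; apply: measurable_row_uncons => //.
  exact: measurableX.
rewrite /row_product /pushforward -comp_preimage.
rewrite (_ : _ \o _ = id) ?preimage_id; last first.
  by apply/funext => p /=; rewrite row_consK.
by rewrite product_measure1E// lte_mul_pinfty// ge0_fin_numE.
Qed.

HB.instance Definition _ :=
  Measure_isSigmaFinite.Build _ _ _ row_product row_product_sigma_finite.

End product_step.

(* mu^{(x) n} on R^n. *)
Fixpoint power_measure (R : realType)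
    (mu : {sigma_finite_measure set (measurableTypeR R) -> \bar R}) (n : nat) :
    {sigma_finite_measure set 'rV[R]_n -> \bar R} :=
  match n with
  | 0 => dirac (0 : 'rV[R]_0)
  | m.+1 => row_product mu (power_measure mu m)
  end.

Lemma power_measure_box (R : realType)
    (mu : {sigma_finite_measure set (measurableTypeR R) -> \bar R}) (n : nat)
    (A : 'I_n -> set (measurableTypeR R)) :
  (forall i, measurable (A i)) ->
  power_measure mu n [set x | forall i, A i (x ord0 i)] =
  (\prod_(i < n) mu (A i))%E.
Proof.
elim: n A => [|n IH] A mA.
  by rewrite big_ord0 /= diracE mem_set//= => -[].
rewrite big_ord_recl -(IH (fun i => A (lift ord0 i))) //=.
rewrite -product_measure1E//; last first.
  rewrite [X in measurable X](_ : _ = \bigcap_(i in [set: 'I_n])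
     ((fun x : 'rV[R]_n => x ord0 i : measurableTypeR R) @^-1`
      A (lift ord0 i))); last first.
    by apply/seteqP; split => [x /= Ax i _|x /= Ax i]; [exact: Ax|exact: Ax].
  apply: fin_bigcap_measurable => // i _; rewrite -[X in measurable X]setTI.
  exact: measurable_coord.
congr (product_measure1 _ _ _); apply/seteqP.
split => [p /= Ap|p /= [A0 AS] i].
  split; first by have := Ap ord0; rewrite row_cons0.
  by move=> i; have := Ap (lift ord0 i); rewrite row_consS.
by case: (unliftP ord0 i) => [j ->|->]; rewrite ?row_consS ?row_cons0.
Qed.

Section euclidean.
Variables (R : realType) (n : nat).

(* The library's norm `|x| on 'rV[R]_n is the sup norm. *)
Definition enorm (x : 'rV[R]_n) : R := Num.sqrt (\sum_(i < n) x ord0 i ^+ 2).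

Definition eball (r : R) : set 'rV[R]_n := [set x | enorm x <= r].

End euclidean.
Arguments eball {R} n r.

Section minimax_risk.
Variables (R : realType) (n : nat).

(* N(0, sigma^2 I): the law of n independent N(0, sigma^2) coordinates. *)
Definition normal_row (sigma : R) : set 'rV[R]_n -> \bar R :=
  power_measure (normal_prob 0 sigma) n.

HB.instance Definition _ sigma := Measure.on (normal_row sigma).

Let normal_row_setT sigma : normal_row sigma [set: _] = 1%E.
Proof.
have := @power_measure_box R (normal_prob 0 sigma) n (fun=> setT)
  (fun=> measurableT).
rewrite big1; last by move=> i _; exact: probability_setT.
by rewrite (_ : [set x | _] = setT)//; apply/seteqP; split.
Qed.

HB.instance Definition _ sigma := @Measure_isProbability.Build _ _ _
  (normal_row sigma) (normal_row_setT sigma).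

Definition mean_squared_error (sigma : R) (M : 'rV[R]_n -> 'rV[R]_n)
    (x : 'rV[R]_n) : \bar R :=
  'E_(normal_row sigma)[(fun w => enorm (x - M (x + w)) ^+ 2)].

Definition minimax_risk (X : set 'rV[R]_n) (sigma : R) : \bar R :=
  ereal_inf [set ereal_sup [set mean_squared_error sigma M x | x in X]
            | M in [set M | measurable_fun [set: 'rV[R]_n] M]].

End minimax_risk.
Arguments normal_row {R} n sigma.

Definition volume (R : realType) (k : nat) :
    {sigma_finite_measure set 'rV[R]_k -> \bar R} :=
  power_measure lebesgue_measure k.

Section volume_ratio.
Variables (R : realType) (n : nat).

(* The k x n matrices U whose rows form an orthonormal basis of H; then
   t |-> t *m U is a linear isometry of R^k onto H. *)
Definition orthonormal_basis (k : nat) (H : {vspace 'rV[R]_n}) :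
    set 'M[R]_(k, n) :=
  [set U | U *m U^T = 1%:M /\
           [set t *m U | t in [set: 'rV[R]_k]] = [set x | x \in H]].
Arguments orthonormal_basis : clear implicits.

Lemma exists_orthonormal_basis (k : nat) (H : {vspace 'rV[R]_n}) :
  \dim H = k -> orthonormal_basis k H !=set0.
Proof.
elim: k H => [|k IH] H dimH.
  exists 0; split; first by rewrite [LHS]flatmx0 [RHS]flatmx0.
  have /eqP -> : H == 0%VS by rewrite -dimv_eq0 dimH.
  apply/seteqP; split => [x [t _ <-]|x /=]; first by rewrite mulmx0 /= mem0v.
  by rewrite memv0 => /eqP ->; exists 0 => //; rewrite mulmx0.
pose v := vpick H.
have v0 : v != 0 by rewrite /v vpick0 -dimv_eq0 dimH.
have vvE : (v *m v^T) ord0 ord0 = \sum_(i < n) v ord0 i ^+ 2.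
  by rewrite mxE; apply: eq_bigr => i _; rewrite mxE expr2.
have s0 : 0 < \sum_(i < n) v ord0 i ^+ 2.
  rewrite lt_neqAle sumr_ge0 ?andbT; last by move=> i _; exact: sqr_ge0.
  apply: contra v0; rewrite eq_sym psumr_eq0; last by move=> i _; exact: sqr_ge0.
  move=> /allP vi0; apply/eqP/rowP => i; rewrite mxE.
  by apply/eqP; rewrite -sqrf_eq0; apply: vi0; rewrite mem_index_enum.
pose u := (Num.sqrt (\sum_(i < n) v ord0 i ^+ 2))^-1 *: v.
have uH : u \in H by rewrite memvZ// memv_pick.
have uu : u *m u^T = 1%:M.
  apply/matrixP => i j; rewrite !ord1 /u linearZ/= -scalemxAl -scalemxAr scalerA.
  rewrite mxE vvE mxE eqxx -invfM -expr2 sqr_sqrtr ?ltW// mulVf//.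
  by rewrite gt_eqF.
pose f := linfun (mulmxr u^T : 'rV[R]_n -> 'rV[R]_1).
have fE x : f x = x *m u^T by rewrite lfunE.
have dimK : \dim (H :&: lker f) = k.
  have := limg_ker_dim f H; rewrite dimH.
  suff -> : \dim (f @: H) = 1%N by rewrite addn1 => -[].
  apply/eqP; rewrite eqn_leq; apply/andP; split.
    by rewrite (leq_trans (dimvS (subvf _)))// dimvf /dim/= muln1.
  rewrite lt0n dimv_eq0; apply/negP => /eqP fH0.
  have : f u \in (f @: H)%VS by exact: memv_img.
  rewrite fH0 memv0 fE uu => /eqP/matrixP/(_ ord0 ord0)/eqP.
  by rewrite !mxE oner_eq0.
have [U [UU UK]] := IH _ dimK.
have memK x : x \in (H :&: lker f)%VS = (x \in H) && (x *m u^T == 0).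
  by rewrite memv_cap memv_ker fE.
have UKt t : t *m U \in (H :&: lker f)%VS.
  by have : [set x | x \in (H :&: lker f)%VS] (t *m U) by rewrite -UK; exists t.
have Uu : U *m u^T = 0.
  apply/row_matrixP => i; rewrite row_mul row0.
  by have := UKt (delta_mx 0 i); rewrite memK -rowE => /andP[_ /eqP].
have uU : u *m U^T = 0 by rewrite -[LHS]trmxK trmx_mul trmxK Uu trmx0.
exists (col_mx u U : 'M[R]_(1 + k, n)); split.
  rewrite (tr_col_mx u U) [LHS](mul_col_row u U u^T U^T) uu UU uU Uu.
  by rewrite -scalar_mx_block.
apply/seteqP; split => [x [t _ <-]|x xH] /=.
  rewrite -[t](@hsubmxK _ 1 1 k) (mul_row_col _ _ u U) memvD//.
    by rewrite [lsubmx _]mx11_scalar mul_scalar_mx memvZ.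
  by have := UKt (rsubmx (t : 'rV_(1 + k))); rewrite memK => /andP[].
have : [set x | x \in (H :&: lker f)%VS] (x - x *m u^T *m u).
  rewrite /= memK mulmxBl -(mulmxA _ u) uu mulmx1 subrr eqxx andbT.
  by rewrite memvB// [_ *m u^T]mx11_scalar mul_scalar_mx memvZ.
rewrite -UK => -[t _ tE]; exists (row_mx (x *m u^T) t : 'rV_(1 + k)) => //.
by rewrite (mul_row_col _ _ u U) tE addrC subrK.
Qed.

(* vol_k on a k-dimensional subspace H, read through an isometric
   parametrization of H; by rotation invariance of Lebesgue measure on R^k the
   value does not depend on the orthonormal basis that xget picks. *)
Definition subspace_volume (k : nat) (H : {vspace 'rV[R]_n})
    (A : set 'rV[R]_n) : \bar R :=
  volume R k [set t | A (t *m xget 0 (orthonormal_basis k H))].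

(* For k = \dim H > 0 and r > 0 both volumes are finite and the second one is
   positive, so fine and the division are harmless. *)
Definition volume_ratio (k : nat) (H : {vspace 'rV[R]_n})
    (X : set 'rV[R]_n) (r : R) : R :=
  (fine (subspace_volume k H (X `&` [set x | x \in H] `&` eball n r)) /
   fine (volume R k (eball k r))) `^ k%:R^-1.

(* A supremum, which is a maximum when X is compact. *)
Definition max_volume_ratio (k : nat) (X : set 'rV[R]_n) (r : R) : \bar R :=
  ereal_sup [set (volume_ratio k H X r)%:E | H in [set H | \dim H = k]].

(* Valued in \bar R so that no finiteness is presupposed; the maximum with 0
   implements the convention sup set0 = 0. *)
Definition approx_radius (c : R) (k : nat) (X : set 'rV[R]_n) : \bar R :=
  maxe 0%E (ereal_sup [set r%:E |
    r in [set r | 0 < r /\ (c%:E <= max_volume_ratio k X r)%E]]).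

End volume_ratio.

(* Main.v *)
Require Import Defs.
From HB Require Import structures.
From mathcomp Require Import all_boot all_order all_algebra.
From mathcomp Require Import all_classical all_reals all_analysis.
From mathcomp Require Import measurable_realfun.
From mathcomp Require Import ring lra.

Import Order.TTheory GRing.Theory Num.Theory.
Import numFieldNormedType.Exports.

Local Open Scope classical_set_scope.
Local Open Scope ring_scope.

(** The minimax risk dominates the Bayes risk for any prior, and a good prior
is the uniform one on a slice of X: take a k-dimensional subspace H on which X
has volume ratio at least c/2 at some radius, shrink X :&: H towards the origin
until its radius rho satisfies rho^2 <= k sigma^2, and parametrize it by a set
T of R^k through an orthonormal matrix U. Shrinking stays inside X because X is
convex and contains 0, and it preserves the volume ratio
(volume_ratio_minimax_lower).

At noise level sigma, the law of the observation t *m U + w then differs little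
from the law of the noise w alone: the second moment of its likelihood ratio is
exp (|t|^2 / sigma^2) <= exp k <= 4^k (integral_likelihood_ratio_sqr,
expR_natr_le). By the pointwise inequality 1_S L <= (s 1_S + L^2 / s) / 2, an
estimator that is within eps of x = t *m U with probability at least 4/5
under the true law is within eps of x with probability at least (4/5) / 5^k
under the pure noise law, the choice s = 5^k making the contribution of L^2 at
most (4/5)^k / 2 (mean_squared_error_lower).

Under the pure noise law, however, the estimate does not depend on t. So by
Tonelli the average over T of the probability of being within eps of t *m U is
at most vol (B (eps)) / vol T, because the points of a k-dimensional subspace
lying in a ball of radius eps of R^n form a subset of a k-dimensional ball of
radius eps (volume_mean_hitting). With eps = (3/20) c' rho and vol T at least
c'^k vol (B (rho)) this ratio is at most (3/20)^k, which is smaller than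
(4/5) / 5^k. Hence some point of T has risk at least eps^2 / 5
(slice_minimax_lower).

The constants leave room: c' = c/2 and rho half of the target radius avoid any
discussion of whether the suprema in the definitions are attained, and
(1/5) (3/20)^2 / 16 = 2.8125 * 10^-4 exceeds 2.46 * 10^-4. *)

(** * Coordinatewise substitution in product measures *)

Section row_integrals.
Variable R : realType.

Lemma integral_row_product (n : nat)
    (mu : {sigma_finite_measure set (measurableTypeR R) -> \bar R})
    (nu : {sigma_finite_measure set 'rV[R]_n -> \bar R})
    (f : 'rV[R]_n.+1 -> \bar R) :
  measurable_fun [set: 'rV[R]_n.+1] f -> (forall x, 0 <= f x)%E ->
  (\int[row_product mu nu]_x f x =
   \int[mu]_s \int[nu]_u f (row_cons (s, u)))%E.
Proof.
move=> mf f0.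
rewrite (ge0_integral_pushforward (@measurable_row_cons R n) (mu \x nu)%E)//.
rewrite preimage_setT fubini_tonelli1//.
  exact: (measurableT_comp mf (@measurable_row_cons R n)).
by move=> p; exact: f0.
Qed.

Lemma measurable_row_cons_comp (n : nat) d (T : measurableType d)
    (a : T -> measurableTypeR R) (b : T -> 'rV[R]_n) :
  measurable_fun [set: T] a -> measurable_fun [set: T] b ->
  measurable_fun [set: T] (fun t => row_cons (a t, b t)).
Proof.
move=> ma mb; apply: (measurableT_comp (@measurable_row_cons R n)).
exact: measurable_fun_pair.
Qed.

(** A change of variables that holds in each coordinate, with density g i,
holds in the product with the product density, by Tonelli and induction on the
dimension. Volume scaling and the Gaussian shift are both instances of it. *)
Lemma power_measure_subst
    (mu : {sigma_finite_measure set (measurableTypeR R) -> \bar R}) (n : nat)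
    (phi : 'I_n -> measurableTypeR R -> measurableTypeR R)
    (g : 'I_n -> measurableTypeR R -> R) :
  (forall i, measurable_fun [set: _] (phi i)) ->
  (forall i, measurable_fun [set: _] (g i)) ->
  (forall i s, 0 <= g i s) ->
  (forall i (f : measurableTypeR R -> \bar R),
     measurable_fun [set: _] f -> (forall s, 0 <= f s)%E ->
     (\int[mu]_s f (phi i s) = \int[mu]_s (f s * (g i s)%:E))%E) ->
  forall f : 'rV[R]_n -> \bar R,
    measurable_fun [set: 'rV[R]_n] f -> (forall x, 0 <= f x)%E ->
    (\int[power_measure mu n]_x f (\row_i phi i (x ord0 i)) =
     \int[power_measure mu n]_x (f x * (\prod_i g i (x ord0 i))%:E))%E.
Proof.
elim: n phi g => [|n IH] phi g mphi mg g0 subst f mf f0.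
  apply: eq_integral => x _; rewrite big_ord0 mule1; congr f.
  by apply/rowP => -[].
have mprod m (h : 'I_m -> measurableTypeR R -> R) :
    (forall i, measurable_fun [set: _] (h i)) ->
    measurable_fun [set: 'rV[R]_m] (fun x => \prod_i h i (x ord0 i)).
  move=> mh; apply: measurable_prod => i _.
  exact: (measurableT_comp (mh i) (measurable_coord i)).
have mrow m (h : 'I_m -> measurableTypeR R -> measurableTypeR R) :
    (forall i, measurable_fun [set: _] (h i)) ->
    measurable_fun [set: 'rV[R]_m] (fun x => \row_i h i (x ord0 i)).
  move=> mh; apply/measurable_fun_rowP => i; under eq_fun do rewrite mxE.
  exact: (measurableT_comp (mh i) (measurable_coord i)).
pose G (u : 'rV[R]_n) : R := \prod_(i < n) g (lift ord0 i) (u ord0 i).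
pose h (p : measurableTypeR R * 'rV[R]_n) := (f (row_cons p) * (G p.2)%:E)%E.
have G0 u : 0 <= G u by apply: prodr_ge0 => i _; exact: g0.
have mG : measurable_fun [set: 'rV[R]_n] G.
  by apply: (mprod n (fun i => g (lift ord0 i))) => i; exact: mg.
have mh : measurable_fun [set: _] h.
  apply: emeasurable_funM.
    exact: (measurableT_comp mf (@measurable_row_cons R n)).
  apply/measurable_EFinP; exact: (measurableT_comp mG measurable_snd).
have h0 p : (0 <= h p)%E by rewrite mule_ge0// lee_fin.
have mf1 : measurable_fun [set: 'rV[R]_n.+1]
    (fun x => f (\row_i phi i (x ord0 i))).
  by apply: (measurableT_comp mf); exact: mrow.
have mf2 : measurable_fun [set: 'rV[R]_n.+1]
    (fun x => (f x * (\prod_i g i (x ord0 i))%:E)%E).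
  by apply: emeasurable_funM => //; apply/measurable_EFinP; exact: mprod.
have f2_ge0 x : (0 <= f x * (\prod_i g i (x ord0 i))%:E)%E.
  by rewrite mule_ge0// lee_fin prodr_ge0.
rewrite !integral_row_product//.
transitivity (\int[mu]_s (fubini_F (power_measure mu n) h (phi ord0 s)))%E.
  apply: eq_integral => s _; rewrite /fubini_F /h /=.
  rewrite -(IH (fun i => phi (lift ord0 i)) (fun i => g (lift ord0 i))
    (fun i => mphi _) (fun i => mg _) (fun i => g0 _) (fun i => subst _)
    (fun u => f (row_cons (phi ord0 s, u)))) //.
    apply: eq_integral => u _; congr f; apply/rowP => i; rewrite mxE.
    by case: (unliftP ord0 i) => [j ->|->]; rewrite ?row_consS ?row_cons0 ?mxE.
  apply: (measurableT_comp mf); exact: measurable_row_cons_comp.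
have mH : measurable_fun [set: _] (fubini_F (power_measure mu n) h).
  exact: measurable_fun_fubini_tonelli_F.
have H_ge0 s : (0 <= fubini_F (power_measure mu n) h s)%E.
  by apply: integral_ge0 => u _; exact: h0.
rewrite subst//.
apply: eq_integral => s _; rewrite /fubini_F muleC -ge0_integralZl//.
- apply: eq_integral => u _; rewrite /h/= big_ord_recl row_cons0 /=.
  rewrite muleCA -EFinM; congr (_ * (_ * _)%:E)%E.
  by apply: eq_bigr => i _; rewrite row_consS.
- exact: (measurableT_comp mh (measurable_pair1 s)).
- by rewrite lee_fin.
Qed.

End row_integrals.

(** * Substitutions for Lebesgue and Gaussian measures on the line *)

Section coordinate_substitutions.
Variable R : realType.
Local Notation leb := (@lebesgue_measure R).

Lemma integral_lebesgue_affine (a b : R) (f : measurableTypeR R -> \bar R) :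
  0 < a -> measurable_fun [set: _] f -> (forall s, 0 <= f s)%E ->
  (\int[leb]_s f (a * s + b)%R = \int[leb]_s (f s * (a^-1)%:E))%E.
Proof.
move=> a0 mf f0.
pose T : measurableTypeR R -> measurableTypeR R := fun s => a * s + b.
have mT : measurable_fun [set: _] T.
  by apply: measurable_funD => //; exact: measurable_funM.
have ai0 : 0 <= a^-1 by rewrite invr_ge0 ltW.
have TE (A : set (measurableTypeR R)) : measurable A ->
    pushforward leb T A = ((a^-1)%:E * leb A)%E.
  move=> mA; have a1 : 0 <= a by exact: ltW.
  have -> : leb A = (a%:E * pushforward leb T A)%E; last first.
    by rewrite muleA -EFinM mulVf ?gt_eqF// mul1e.
  apply: (@lebesgue_measure_unique R
    (mscale (NngNum a1) (pushforward leb T))) => // _ [[x y] _ <-].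
  change (leb `]x, y] = (a%:E * leb (T @^-1` `]x, y]))%E).
  have -> : T @^-1` `]x, y] = `](x - b) / a, (y - b) / a]%classic.
    apply/seteqP; split => s /=; rewrite !in_itv/= /T.
      by rewrite ltr_pdivrMr// ler_pdivlMr// ltrBlDr lerBrDr mulrC.
    by rewrite ltr_pdivrMr// ler_pdivlMr// ltrBlDr lerBrDr mulrC.
  rewrite !lebesgue_measure_itv/= !lte_fin ltr_pM2r ?invr_gt0//.
  rewrite ltrD2r; case: ifP => _; rewrite ?mule0// -!EFinD -EFinM; congr (_%:E).
  by field; rewrite gt_eqF.
rewrite (_ : (\int[leb]_s f (a * s + b)%R)%E = (\int[leb]_s (f \o T) s)%E)//.
rewrite -[in LHS](preimage_setT T) -ge0_integral_pushforward//.
rewrite (eq_measure_integral (mscale (NngNum ai0) leb)); last first.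
  by move=> A mA _; exact: TE.
rewrite ge0_integral_mscale//= muleC -ge0_integralZr//.
Qed.

(** The Radon-Nikodym derivative of the normal law agrees almost everywhere
with its explicit density, because both integrate to the law on every set. *)
Lemma integral_normal_prob (sigma : R) (f : measurableTypeR R -> \bar R) :
  measurable_fun [set: _] f -> (forall s, 0 <= f s)%E ->
  (\int[normal_prob 0 sigma]_s f s =
   \int[leb]_s (f s * (normal_pdf 0 sigma s)%:E))%E.
Proof.
move=> mf f0; have dom := @normal_prob_dominates R 0 sigma.
rewrite -(Radon_Nikodym_SigmaFinite.change_of_variables dom)//.
have fi := Radon_Nikodym_SigmaFinite.f_integrable dom.
apply: ge0_ae_eq_integral => //.
- by apply: emeasurable_funM => //; exact: measurable_int fi.
- apply: emeasurable_funM => //; apply/measurable_EFinP.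
  exact: measurable_normal_pdf.
- move=> s _; rewrite mule_ge0//; exact: Radon_Nikodym_SigmaFinite.f_ge0.
- by move=> s _; rewrite mule_ge0// lee_fin normal_pdf_ge0.
apply: ae_eqe_mul2l; apply: integral_ae_eq => //.
- by apply/measurable_EFinP; exact: measurable_normal_pdf.
- by move=> E _ mE; rewrite -Radon_Nikodym_SigmaFinite.f_integral.
Qed.

(** One-dimensional Cameron-Martin formula: the ratio of the densities of
N(a, sigma^2) and N(0, sigma^2) is an exponential of a linear function. *)
Lemma integral_normal_shift (sigma a : R) (f : measurableTypeR R -> \bar R) :
  0 < sigma -> measurable_fun [set: _] f -> (forall s, 0 <= f s)%E ->
  (\int[normal_prob 0 sigma]_s f (s + a)%R =
   \int[normal_prob 0 sigma]_s
     (f s * (expR (a * s / sigma ^+ 2 - a ^+ 2 / (2 * sigma ^+ 2)))%:E))%E.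
Proof.
move=> s0 mf f0; have sn0 : sigma != 0 by rewrite gt_eqF.
have mshift : measurable_fun [set: measurableTypeR R]
    (fun s : measurableTypeR R => s + a : measurableTypeR R).
  exact: measurable_funD.
have mexp : measurable_fun [set: measurableTypeR R]
    (fun s => expR (a * s / sigma ^+ 2 - a ^+ 2 / (2 * sigma ^+ 2))).
  apply: measurableT_comp => //; apply: measurable_funB => //.
  by apply: measurable_funM => //; exact: measurable_funM.
pose h (s : measurableTypeR R) : \bar R :=
  (f s * (normal_pdf 0 sigma (s - a))%:E)%E.
rewrite integral_normal_prob//; last exact: (measurableT_comp mf).
rewrite integral_normal_prob//; first last.
- by move=> s; rewrite mule_ge0// lee_fin expR_ge0.
- by apply: emeasurable_funM => //; exact/measurable_EFinP.
transitivity (\int[leb]_s h (1 * s + a)%R)%E.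
  by apply: eq_integral => s _; rewrite /h mul1r addrK.
rewrite integral_lebesgue_affine//; first last.
- by move=> s; rewrite mule_ge0// lee_fin normal_pdf_ge0.
- apply: emeasurable_funM => //; apply/measurable_EFinP.
  apply: (measurableT_comp (@measurable_normal_pdf R 0 sigma)).
  exact: measurable_funB.
apply: eq_integral => s _; rewrite invr1 mule1 /h -muleA -EFinM.
congr (_ * _%:E)%E; rewrite !normal_pdfE// mulrCA; congr (_ * _).
rewrite /normal_fun -expRD; congr expR.
by field.
Qed.

End coordinate_substitutions.

(** * Volume scaling and Gaussian likelihood ratios *)

Section row_measures.
Variable R : realType.

Lemma integral_volume_affine (k : nat) (a : R) (v : 'rV[R]_k)
    (f : 'rV[R]_k -> \bar R) :
  0 < a -> measurable_fun [set: 'rV[R]_k] f -> (forall x, 0 <= f x)%E ->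
  (\int[volume R k]_t f (a *: t + v)%R =
   (a^-1 ^+ k)%:E * \int[volume R k]_t f t)%E.
Proof.
move=> a0 mf f0.
have := @power_measure_subst R lebesgue_measure k
  (fun i s => a * s + v ord0 i) (fun _ _ => a^-1) _ _ _ _ f mf f0.
rewrite -/(volume R k) => subst; rewrite -ge0_integralZl//; last first.
  by rewrite lee_fin exprn_ge0// invr_ge0 ltW.
transitivity (\int[volume R k]_x
    f (\row_i (a * x ord0 i + v ord0 i)%R))%E.
  by apply: eq_integral => x _; congr f; apply/rowP => i; rewrite !mxE.
rewrite subst => //.
- by apply: eq_integral => x _; rewrite prodr_const card_ord muleC.
- by move=> i; apply: measurable_funD => //; exact: measurable_funM.
- by move=> _ _; rewrite invr_ge0 ltW.
- by move=> i g mg g0; exact: integral_lebesgue_affine.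
Qed.

Lemma measurable_row_affine (k : nat) (a : R) (v : 'rV[R]_k) :
  measurable_fun [set: 'rV[R]_k] (fun t => a *: t + v).
Proof.
apply/measurable_fun_rowP => i; under eq_fun do rewrite !mxE.
apply: measurable_funD => //; apply: measurable_funM => //.
exact: measurable_coord.
Qed.

Lemma volume_affine (k : nat) (a : R) (v : 'rV[R]_k) (A : set 'rV[R]_k) :
  0 < a -> measurable A ->
  volume R k [set t | A (a *: t + v)] = ((a^-1 ^+ k)%:E * volume R k A)%E.
Proof.
move=> a0 mA; have mpre : measurable [set t | A (a *: t + v)].
  by rewrite -[X in measurable X]setTI; exact: measurable_row_affine.
rewrite -[in LHS](setIT [set t | _]) -[X in (_ * volume R k X)%E]setIT.
rewrite -!integral_indic// -(@integral_volume_affine k a v)//.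
by apply/measurable_EFinP; exact: measurable_indic.
Qed.

(** The density of N(x, sigma^2 I) relative to N(0, sigma^2 I). *)
Definition likelihood_ratio (n : nat) (sigma : R) (x w : 'rV[R]_n) : R :=
  expR ((\sum_(i < n) x ord0 i * w ord0 i) / sigma ^+ 2
        - enorm x ^+ 2 / (2 * sigma ^+ 2)).
Arguments likelihood_ratio {n} sigma x w.

Lemma enorm_sqr (n : nat) (x : 'rV[R]_n) :
  enorm x ^+ 2 = \sum_(i < n) x ord0 i ^+ 2.
Proof. by rewrite sqr_sqrtr// sumr_ge0// => i _; exact: sqr_ge0. Qed.

Lemma measurable_likelihood_ratio (n : nat) (sigma : R) (x : 'rV[R]_n) :
  measurable_fun [set: 'rV[R]_n] (likelihood_ratio sigma x).
Proof.
apply: measurableT_comp => //; apply: measurable_funB => //.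
apply: measurable_funM => //; apply: measurable_sum => i.
by apply: measurable_funM => //; exact: measurable_coord.
Qed.

Lemma integral_normal_row_shift (n : nat) (sigma : R) (x : 'rV[R]_n)
    (f : 'rV[R]_n -> \bar R) :
  0 < sigma -> measurable_fun [set: 'rV[R]_n] f -> (forall w, 0 <= f w)%E ->
  (\int[normal_row n sigma]_w f (x + w)%R =
   \int[normal_row n sigma]_w (f w * (likelihood_ratio sigma x w)%:E))%E.
Proof.
move=> s0 mf f0.
have subst := @power_measure_subst R (normal_prob 0 sigma) n
  (fun i s => s + x ord0 i)
  (fun i s => expR (x ord0 i * s / sigma ^+ 2
                    - x ord0 i ^+ 2 / (2 * sigma ^+ 2))) _ _ _ _ f mf f0.
transitivity (\int[normal_row n sigma]_w
    f (\row_i (w ord0 i + x ord0 i)%R))%E.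
  by apply: eq_integral => w _; congr f; apply/rowP => i; rewrite !mxE addrC.
rewrite [LHS]subst.
- apply: eq_integral => w _; rewrite -expR_sum; congr (_ * (expR _)%:E)%E.
  by rewrite sumrB enorm_sqr -!mulr_suml.
- by move=> i; exact: measurable_funD.
- move=> i; apply: measurableT_comp => //; apply: measurable_funB => //.
  by apply: measurable_funM => //; exact: measurable_funM.
- by move=> i s; exact: expR_ge0.
- by move=> i g mg g0; exact: integral_normal_shift.
Qed.

(** The square of the likelihood ratio at x is a constant multiple of the
likelihood ratio at 2 x, and the latter integrates to 1. *)
Lemma integral_likelihood_ratio_sqr (n : nat) (sigma : R) (x : 'rV[R]_n) :
  0 < sigma ->
  (\int[normal_row n sigma]_w (likelihood_ratio sigma x w ^+ 2)%:E =
   (expR (enorm x ^+ 2 / sigma ^+ 2))%:E)%E.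
Proof.
move=> s0; have sn0 : sigma != 0 by rewrite gt_eqF.
have total : (\int[normal_row n sigma]_w
    (likelihood_ratio sigma (2 *: x)%R w)%:E = 1)%E.
  transitivity (\int[normal_row n sigma]_w cst 1%E w)%E; last first.
    by rewrite integral_cst// mul1e; exact: probability_setT.
  rewrite [RHS](@integral_normal_row_shift n sigma (2 *: x) (cst 1%E))//.
  by apply: eq_integral => w _; rewrite /= mul1e.
transitivity (\int[normal_row n sigma]_w
   ((expR (enorm x ^+ 2 / sigma ^+ 2))%:E *
    (likelihood_ratio sigma (2 *: x)%R w)%:E))%E.
  apply: eq_integral => w _; rewrite -EFinM; congr (_%:E).
  rewrite /likelihood_ratio -expRM_natl -expRD; congr expR.
  rewrite !enorm_sqr.
  have -> : \sum_(i < n) (2 *: x) ord0 i * w ord0 i =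
            2 * \sum_(i < n) x ord0 i * w ord0 i.
    by rewrite mulr_sumr; apply: eq_bigr => i _; rewrite mxE mulrA.
  have -> : \sum_(i < n) (2 *: x) ord0 i ^+ 2 =
            4 * \sum_(i < n) x ord0 i ^+ 2.
    by rewrite mulr_sumr; apply: eq_bigr => i _; rewrite mxE; ring.
  by field.
rewrite ge0_integralZl//.
- by rewrite total mule1.
- by apply/measurable_EFinP; exact: measurable_likelihood_ratio.
- by move=> w _; rewrite lee_fin expR_ge0.
Qed.

End row_measures.
Arguments likelihood_ratio {R n} sigma x w.

(** * Euclidean geometry and measurability of compact sets *)

Section geometry.
Variable R : realType.

Lemma enorm_ge0 (n : nat) (x : 'rV[R]_n) : 0 <= enorm x.
Proof. exact: sqrtr_ge0. Qed.

Lemma enorm_leE (n : nat) (x : 'rV[R]_n) (r : R) :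
  0 <= r -> (enorm x <= r) = (enorm x ^+ 2 <= r ^+ 2).
Proof. by move=> r0; rewrite ler_sqr// nnegrE enorm_ge0. Qed.

Lemma measurable_enorm_sqr (n : nat) :
  measurable_fun [set: 'rV[R]_n] (fun x => enorm x ^+ 2).
Proof.
under eq_fun do rewrite enorm_sqr.
apply: measurable_sum => i; apply: measurable_funX.
exact: measurable_coord.
Qed.

Lemma measurable_eball (n : nat) (r : R) :
  0 <= r -> measurable (eball n r : set 'rV[R]_n).
Proof.
move=> r0; have -> : eball n r =
    (fun x : 'rV[R]_n => enorm x ^+ 2) @^-1` `]-oo, r ^+ 2].
  by apply/seteqP; split => x /=; rewrite in_itv/= /eball/= enorm_leE.
by rewrite -[X in measurable X]setTI; exact: measurable_enorm_sqr.
Qed.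

Lemma coord_le_enorm (n : nat) (x : 'rV[R]_n) (i : 'I_n) :
  `|x ord0 i| <= enorm x.
Proof.
rewrite -ler_sqr ?nnegrE ?normr_ge0 ?enorm_ge0// enorm_sqr real_normK ?num_real//.
by rewrite (bigD1 i)//= lerDl sumr_ge0// => j _; exact: sqr_ge0.
Qed.

Lemma volume_eball_lty (n : nat) (r : R) :
  0 <= r -> (volume R n (eball n r) < +oo)%E.
Proof.
move=> r0; pose box : set 'rV[R]_n := [set x | forall i,
  (`[- r, r]%classic : set (measurableTypeR R)) (x ord0 i)].
have boxE : volume R n box = (\prod_(i < n) (r - - r)%:E)%E.
  have := @power_measure_box R lebesgue_measure n (fun=> `[- r, r]%classic).
  move=> -> => [|i]; last exact: measurable_itv; apply: eq_bigr => i _.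
  rewrite [LHS](@lebesgue_measure_itv R `[- r, r])/= lte_fin -EFinB.
  by case: ltP => // /(conj r0)/andP ?; congr (_%:E); lra.
have mbox : measurable box.
  rewrite [X in measurable X](_ : _ = \bigcap_(i in [set: 'I_n])
     ((fun x : 'rV[R]_n => x ord0 i : measurableTypeR R) @^-1` `[- r, r]));
    last by apply/seteqP; split => [x bx i _|x bx i]; exact: bx.
  apply: fin_bigcap_measurable => // i _; rewrite -[X in measurable X]setTI.
  exact: measurable_coord.
apply: (@le_lt_trans _ _ (volume R n box)).
  apply: le_measure; rewrite ?inE//; first exact: measurable_eball.
  move=> x xr i /=; rewrite in_itv/= -ler_norml.
  exact: le_trans (coord_le_enorm _ _ _) xr.
by rewrite boxE prodEFin ltry.
Qed.

Lemma enormZ (n : nat) (a : R) (x : 'rV[R]_n) :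
  0 <= a -> enorm (a *: x) = a * enorm x.
Proof.
move=> a0; apply/eqP.
rewrite -(eqrXn2 (_ : (0 < 2)%N)) ?mulr_ge0 ?enorm_ge0// exprMn !enorm_sqr.
by rewrite mulr_sumr; apply/eqP/eq_bigr => i _; rewrite mxE exprMn.
Qed.

Lemma enorm_sqr_mulmx (n : nat) (x : 'rV[R]_n) :
  enorm x ^+ 2 = (x *m x^T) ord0 ord0.
Proof.
by rewrite enorm_sqr mxE; apply: eq_bigr => i _; rewrite mxE expr2.
Qed.

Lemma measurable_mulmx (k n : nat) (U : 'M[R]_(k, n)) :
  measurable_fun [set: 'rV[R]_k] (fun t => t *m U).
Proof.
apply/measurable_fun_rowP => i; under eq_fun do rewrite mxE.
apply: measurable_sum => j; apply: measurable_funM => //.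
exact: measurable_coord.
Qed.

Section isometry.
Variables (k n : nat) (U : 'M[R]_(k, n)).
Hypothesis UU : U *m U^T = 1%:M.

Lemma enorm_isometry (t : 'rV[R]_k) : enorm (t *m U) = enorm t.
Proof.
apply/eqP; rewrite -(eqrXn2 (_ : (0 < 2)%N)) ?enorm_ge0//.
by rewrite !enorm_sqr_mulmx trmx_mul mulmxA -(mulmxA t) UU mulmx1.
Qed.

(** Pythagoras: z is the sum of its projection on the row space of U, whose
coordinates are z *m U^T, and of an orthogonal remainder. *)
Lemma enorm_orthogonal_projection (z : 'rV[R]_n) :
  enorm (z *m U^T) <= enorm z.
Proof.
rewrite enorm_leE ?enorm_ge0// -subr_ge0.
suff <- : enorm (z - z *m U^T *m U) ^+ 2 =
    enorm z ^+ 2 - enorm (z *m U^T) ^+ 2 by exact: sqr_ge0.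
rewrite !enorm_sqr_mulmx linearB/= !trmx_mul trmxK mulmxBl !mulmxBr.
have -> : z *m U^T *m U *m (U^T *m (U *m z^T)) = z *m U^T *m (U *m z^T).
  by rewrite -!mulmxA (mulmxA U U^T) UU mul1mx.
by rewrite !mulmxA subrr subr0 !mxE.
Qed.

(** The ball on the right is written as the preimage of a centred ball by an
affine map, the shape that the scaling lemma for volumes applies to. *)
Lemma slice_ball_sub_ball (m : 'rV[R]_n) (r : R) :
  [set t : 'rV[R]_k | enorm (t *m U - m) <= r] `<=`
  [set t | eball k r (1 *: t + - (m *m U^T))].
Proof.
move=> t /= tr; rewrite /eball/= scale1r.
apply: le_trans tr; have := enorm_orthogonal_projection (t *m U - m).
by rewrite mulmxBl -mulmxA UU mulmx1.
Qed.

End isometry.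

(** The sigma-algebra generated by the coordinates contains all open sets
since an open set is a countable union of cubes with rational centres. *)
Lemma open_measurable_row (n : nat) (A : set 'rV[R]_n) :
  open A -> measurable A.
Proof.
move=> oA.
pose box (p : 'rV[rat]_n * nat) : set 'rV[R]_n :=
  [set x | forall i, `|x ord0 i - ratr (p.1 ord0 i)| < p.2.+1%:R^-1].
have mbox p : measurable (box p).
  rewrite [X in measurable X](_ : _ = \bigcap_(i in [set: 'I_n])
     ((fun x : 'rV[R]_n => `|x ord0 i - ratr (p.1 ord0 i)|) @^-1`
      `]-oo, p.2.+1%:R^-1[)); last first.
    apply/seteqP; split => [x bx i _|x bx i] /=; first by rewrite in_itv/= bx.
    by have := bx i I; rewrite /= in_itv.
  apply: fin_bigcap_measurable => // i _; rewrite -[X in measurable X]setTI.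
  suff : measurable_fun [set: 'rV[R]_n]
    (fun x : 'rV[R]_n => `|x ord0 i - ratr (p.1 ord0 i)|) by apply.
  apply: measurableT_comp => //; apply: measurable_funB => //.
  exact: measurable_coord.
have -> : A = \bigcup_p (if `[< box p `<=` A >] then box p else set0).
  apply/seteqP; split => [x Ax|x [p _]]; last first.
    by case: asboolP => // pA px; exact: pA.
  have /nbhs_ballP[e /= e0 eA] := oA x Ax.
  have [m me] : exists m, m.+1%:R^-1 < e / 2 :> R.
    exists (Num.truncn (e / 2)^-1); rewrite invf_plt ?posrE ?divr_gt0//.
    exact: truncnS_gt.
  have m0 : 0 < m.+1%:R^-1 :> R by rewrite invr_gt0.
  have /choice[q qP] (i : 'I_n) : exists q, `|x ord0 i - ratr q| < m.+1%:R^-1.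
    have [|q] := @rat_in_itvoo R (x ord0 i - m.+1%:R^-1) (x ord0 i + m.+1%:R^-1).
      by rewrite ltrD2l gtrN.
    rewrite in_itv/= => /andP[q1 q2]; exists q.
    by rewrite ltr_distlC q1 q2.
  exists (\row_i q i, m) => //; case: asboolP => [_ i|[]]; first by rewrite /= mxE.
  move=> y ybox; apply: eA; split => // i j.
  have -> : i = ord0 by exact: ord1.
  rewrite /ball/=.
  have /= := ybox j; rewrite mxE distrC => yq.
  rewrite -(subrKA (ratr (q j))) (le_lt_trans (ler_normD _ _))//.
  by rewrite (splitr e) ltrD// (lt_trans _ me).
apply: countable_bigcupT_measurable => [|p]; first exact: countableP.
by case: asboolP.
Qed.

Lemma compact_measurable_row (n : nat) (A : set 'rV[R]_n) :
  compact A -> measurable A.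
Proof.
move=> cA; have clA : closed A by apply: compact_closed => //; exact: norm_hausdorff.
have mC : measurable (~` A) by apply: open_measurable_row; rewrite openC.
by rewrite -(setCK A); exact: measurableC.
Qed.

End geometry.

(** * Testing an estimator against pure noise *)

Section bayes.
Variable R : realType.

Lemma volume_eball_translate (k : nat) (r : R) (v : 'rV[R]_k) :
  0 <= r ->
  volume R k [set t | eball k r (1 *: t + v)] = volume R k (eball k r).
Proof.
move=> r0; rewrite volume_affine//; last exact: measurable_eball.
by rewrite invr1 expr1n mul1e.
Qed.

Lemma volume_eball_scale (k : nat) (a r : R) :
  0 < a -> 0 <= r ->
  volume R k (eball k (a * r)) = ((a ^+ k)%:E * volume R k (eball k r))%E.
Proof.
move=> a0 r0; have ai0 : 0 <= a^-1 by rewrite invr_ge0 ltW.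
rewrite -[in RHS](invrK a) -(@volume_affine R k a^-1 0)//.
- congr (volume R k _); apply/seteqP; split => t; rewrite /eball/= addr0.
    by rewrite enormZ// ler_pdivrMl.
  by rewrite enormZ// ler_pdivrMl.
- by rewrite invr_gt0.
- exact: measurable_eball.
Qed.

Lemma measurable_enorm_le (n : nat) d (T : measurableType d) (f : T -> 'rV[R]_n)
    (r : R) : 0 <= r -> measurable_fun [set: T] f ->
  measurable [set t | enorm (f t) <= r].
Proof.
move=> r0 mf; rewrite -[X in measurable X]setTI.
have := mf measurableT _ (@measurable_eball R n r r0).
by [].
Qed.

Lemma measurable_row_sub (n : nat) d (T : measurableType d)
    (f g : T -> 'rV[R]_n) :
  measurable_fun [set: T] f -> measurable_fun [set: T] g ->
  measurable_fun [set: T] (fun t => f t - g t).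
Proof.
move=> /measurable_fun_rowP mf /measurable_fun_rowP mg.
apply/measurable_fun_rowP => i; under eq_fun do rewrite !mxE.
by apply: measurable_funB; [exact: mf|exact: mg].
Qed.

(** Change of measure from the law of x + w to the law of w. The probability
on the right is computed under pure noise and so with an estimate that does not
know x; s is a free parameter that balances it against the second moment of
the likelihood ratio. *)
Lemma mean_squared_error_lower (n : nat) (sigma : R)
    (M : 'rV[R]_n -> 'rV[R]_n) (x : 'rV[R]_n) (eps s : R) :
  0 < sigma -> measurable_fun [set: 'rV[R]_n] M -> 0 <= eps -> 0 < s ->
  ((eps ^+ 2)%:E <= mean_squared_error sigma M x + (eps ^+ 2 / 2)%:E *
    (s%:E * normal_row n sigma [set w | (enorm (x - M w) <= eps)%R]
     + (s^-1 * expR (enorm x ^+ 2 / sigma ^+ 2))%:E))%E.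
Proof.
move=> sigma0 mM eps0 s0.
set S := [set w | _].
have mS : measurable S by apply: measurable_enorm_le => //; exact: measurable_row_sub.
pose P := normal_row n sigma.
pose f (w : 'rV[R]_n) : \bar R := (\1_S w)%:E.
have f0 w : (0 <= f w)%E by rewrite lee_fin.
have mf : measurable_fun [set: 'rV[R]_n] f.
  by apply/measurable_EFinP; exact: measurable_indic.
have mshift : measurable_fun [set: 'rV[R]_n] (fun w => x + w).
  apply/measurable_fun_rowP => i; under eq_fun do rewrite mxE.
  by apply: measurable_funD => //; exact: measurable_coord.
have merr : measurable_fun [set: 'rV[R]_n]
    (fun w => (enorm (x - M (x + w)) ^+ 2)%:E).
  apply/measurable_EFinP; apply: (measurableT_comp (@measurable_enorm_sqr R n)).
  apply: measurable_row_sub => //; exact: (measurableT_comp mM).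
(* f (x + w) indicates that the estimate made from x + w is within eps of x. *)
have hit : (\int[P]_w f (x + w)%R <=
    2^-1%:E * (s%:E * P S + (s^-1 * expR (enorm x ^+ 2 / sigma ^+ 2))%:E))%E.
  rewrite integral_normal_row_shift//.
  have mL : measurable_fun [set: 'rV[R]_n]
      (fun w => (likelihood_ratio sigma x w)%:E).
    by apply/measurable_EFinP; exact: measurable_likelihood_ratio.
  have mL2 : measurable_fun [set: 'rV[R]_n]
      (fun w => (likelihood_ratio sigma x w ^+ 2)%:E).
    apply/measurable_EFinP; apply: measurable_funX.
    exact: measurable_likelihood_ratio.
  have s_ge0 : 0 <= s by exact: ltW.
  have s2 : 0 <= s / 2 by rewrite divr_ge0// ltW.
  have si2 : 0 <= s^-1 / 2 by rewrite divr_ge0// invr_ge0 ltW.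
  have L0 w : 0 <= likelihood_ratio sigma x w by exact: expR_ge0.
  have L2_ge0 w : (0 <= (likelihood_ratio sigma x w ^+ 2)%:E)%E.
    by rewrite lee_fin sqr_ge0.
  apply: (@le_trans _ _ (\int[P]_w ((s / 2)%:E * f w
      + (s^-1 / 2)%:E * (likelihood_ratio sigma x w ^+ 2)%:E))%E).
    apply: ge0_le_integral => //.
    - by move=> w _; rewrite mule_ge0// lee_fin.
    - exact: emeasurable_funM.
    - by apply: emeasurable_funD; exact: measurable_funeM.
    - move=> w _; rewrite /f -!EFinM -EFinD lee_fin.
      have := L0 w; move: (likelihood_ratio sigma x w) => L {}L0.
      rewrite -subr_ge0; have [wS|wS] := boolP (w \in S); rewrite indicE.
        (* On S the bound s / 2 + L^2 / (2 s) >= L is the AM-GM inequality. *)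
        rewrite wS /= !mul1r mulr1.
        have -> : s / 2 + s^-1 / 2 * L ^+ 2 - L = s^-1 / 2 * (s - L) ^+ 2.
          by field; rewrite gt_eqF.
        by rewrite mulr_ge0// sqr_ge0.
      by rewrite (negbTE wS) /= mul0r mulr0 add0r subr0 mulr_ge0// sqr_ge0.
  rewrite ge0_integralD//; first last.
  - exact: measurable_funeM.
  - by move=> w _; rewrite mule_ge0// lee_fin.
  - exact: measurable_funeM.
  - by move=> w _; rewrite mule_ge0// lee_fin.
  rewrite !ge0_integralZl// ?lee_fin//.
  rewrite integral_likelihood_ratio_sqr// integral_indic// setIT.
  rewrite muleDr// ?ge0_adde_def ?inE ?mule_ge0 ?lee_fin// ?mulr_ge0 ?expR_ge0 ?invr_ge0//.
  by rewrite muleA -!EFinM (mulrC 2^-1 s) (mulrCA 2^-1) mulrA.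
rewrite /mean_squared_error unlock.
apply: (@le_trans _ _ (\int[P]_w ((enorm (x - M (x + w)) ^+ 2)%:E
    + (eps ^+ 2)%:E * f (x + w)%R))%E).
  rewrite -[leLHS]mule1 -(probability_setT P) -integral_cst//.
  apply: ge0_le_integral => //.
  - by move=> w _; rewrite lee_fin sqr_ge0.
  - apply: emeasurable_funD => //; apply: measurable_funeM.
    exact: (measurableT_comp mf).
  - move=> w _; rewrite /f -EFinM -EFinD lee_fin indicE.
    have [wS|wS] := boolP (x + w \in S); first by rewrite mulr1 lerDr sqr_ge0.
    rewrite mulr0 addr0; move: wS; rewrite notin_setE /S /= => /negP.
    by rewrite -ltNge => /ltW h; rewrite lerXn2r ?nnegrE ?enorm_ge0.
rewrite ge0_integralD//; first last.
- by apply: measurable_funeM; exact: (measurableT_comp mf).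
- by move=> w _; rewrite mule_ge0// lee_fin sqr_ge0.
- by move=> w _; rewrite lee_fin sqr_ge0.
rewrite ge0_integralZl//; first last.
- by rewrite lee_fin sqr_ge0.
- exact: (measurableT_comp mf).
rewrite leeD2l// (EFinM _ 2^-1) -muleA; apply: lee_wpmul2l => //.
by rewrite lee_fin sqr_ge0.
Qed.

(** For each fixed w the points t with t *m U within eps of M w form a set
of volume at most that of the ball of radius eps; integrating over w first
bounds the average over t of the probability of being that close. *)
Lemma volume_mean_hitting (k n : nat) (sigma : R) (U : 'M[R]_(k, n))
    (M : 'rV[R]_n -> 'rV[R]_n) (T : set 'rV[R]_k) (eps a : R) :
  U *m U^T = 1%:M -> measurable_fun [set: 'rV[R]_n] M -> measurable T ->
  0 <= eps -> 0 <= a ->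
  (forall t, T t ->
    a%:E <= normal_row n sigma [set w | (enorm (t *m U - M w) <= eps)%R])%E ->
  (a%:E * volume R k T <= volume R k (eball k eps))%E.
Proof.
move=> UU mM mT eps0 a0 aT.
pose B : set ('rV[R]_k * 'rV[R]_n) :=
  [set p | enorm (p.1 *m U - M p.2) <= eps].
have mB : measurable B.
  apply: (@measurable_enorm_le n _ _ (fun p => p.1 *m U - M p.2)) => //.
  apply: measurable_row_sub.
    exact: (measurableT_comp (@measurable_mulmx R k n U) measurable_fst).
  exact: (measurableT_comp mM measurable_snd).
pose P := normal_row n sigma.
have xB t : xsection B t = [set w | enorm (t *m U - M w) <= eps].
  by apply/seteqP; split => w; rewrite /xsection/= inE.
have yB w : ysection B w = [set t | enorm (t *m U - M w) <= eps].
  by apply/seteqP; split => t; rewrite /ysection/= inE.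
have FE := @indic_fubini_tonelli_FE _ _ _ _ R P B mB.
have GE := @indic_fubini_tonelli_GE _ _ _ _ R (volume R k) B mB.
have tonelli := @indic_fubini_tonelli _ _ _ _ R (volume R k) P B mB.
rewrite FE GE in tonelli.
apply: (@le_trans _ _ (\int[volume R k]_t (P \o xsection B) t)%E).
  rewrite -integral_cst//.
  have mF : measurable_fun [set: 'rV[R]_k] (P \o xsection B).
    exact: measurable_fun_xsection.
  apply: (@le_trans _ _ (\int[volume R k]_(t in T) (P \o xsection B) t)%E).
    apply: ge0_le_integral => //.
    - exact: measurable_funTS.
    - by move=> t Tt /=; rewrite xB; exact: aT.
  by apply: ge0_subset_integral => // t _ /=; exact: measure_ge0.
rewrite tonelli.
apply: (@le_trans _ _ (\int[P]_w (cst (volume R k (eball k eps))) w)%E).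
  apply: ge0_le_integral => //.
  - exact: measurable_fun_ysection.
  - move=> w _ /=; rewrite yB -(volume_eball_translate k eps (- (M w *m U^T)))//.
    apply: le_measure; rewrite ?inE.
    + by rewrite -yB; exact: measurable_ysection.
    + have m1 := measurable_row_affine _ k 1 (- (M w *m U^T)) measurableT _
        (measurable_eball _ k eps eps0).
      by rewrite setTI in m1.
    + exact: slice_ball_sub_ball.
rewrite integral_cst// [X in (_ * X)%E](_ : _ = 1%E) ?mule1//.
exact: probability_setT.
Qed.

End bayes.

(** * Bayes risk of the uniform prior on a slice *)

Section minimax_lower_bound.
Variable R : realType.

Lemma expR_natr_le (k : nat) : expR (k%:R : R) <= 4 ^+ k.
Proof.
(* The bound e <= 4 follows from exp (- 1/2) >= 1 - 1/2. *)
have half : 2^-1 <= expR (- 2^-1 : R).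
  by apply: le_trans (expR_ge1Dx _); lra.
have two : expR (2^-1 : R) <= 2.
  rewrite -[X in expR X]opprK expRN -[leRHS]invrK lef_pV2// posrE.
    exact: expR_gt0.
  by rewrite invr_gt0.
have -> : k%:R = k%:R * (2^-1 + 2^-1) :> R by field.
have -> : 4 = 2 * 2 :> R by lra.
rewrite expRM_natl lerXn2r ?nnegrE ?expR_ge0// expRD.
by apply: ler_pM => //; exact: expR_ge0.
Qed.

(** If the risk were smaller than eps^2 / 5 on all of T, every t in T would be
hit under pure noise with probability at least (4/5) / 5^k, which is more than
the volumes of T and of the ball of radius eps allow. *)
Lemma slice_minimax_lower (k n : nat) (X : set 'rV[R]_n) (sigma c r : R)
    (U : 'M[R]_(k, n)) (T : set 'rV[R]_k) :
  (0 < k)%N -> 0 < sigma -> U *m U^T = 1%:M -> measurable T ->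
  (forall t, T t -> X (t *m U)) -> (forall t, T t -> enorm t <= r) ->
  0 < r -> r ^+ 2 <= k%:R * sigma ^+ 2 -> 0 < c ->
  (0 < volume R k T)%E ->
  ((c ^+ k)%:E * volume R k (eball k r) <= volume R k T)%E ->
  ((5^-1 * (3 / 20 * c * r) ^+ 2)%:E <= minimax_risk X sigma)%E.
Proof.
move=> k0 sigma0 UU mT TX Tr r0 rk c0 T0 Tc.
apply: le_ereal_inf_tmp => _ [M mM <-]; rewrite leNgt; apply/negP => risk_lt.
pose d := 3 / 20 * c; pose eps := d * r.
have d0 : 0 < d by rewrite mulr_gt0.
have eps0 : 0 < eps by rewrite mulr_gt0.
have Tfin : (volume R k T < +oo)%E.
  apply: le_lt_trans (volume_eball_lty R k r (ltW r0)).
  by apply: le_measure; rewrite ?inE//; exact: measurable_eball (ltW r0).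
have q1 : (4 / 5) ^+ k <= 4 / 5 :> R.
  case: k k0 {U T UU mT TX Tr rk T0 Tc Tfin} => // k _.
  by rewrite exprS ler_piMr// exprn_ile1//; lra.
have hit t : T t -> ((4 / 5 / 5 ^+ k)%:E <=
    normal_row n sigma [set w | (enorm (t *m U - M w) <= eps)%R])%E.
  move=> Tt; set p := normal_row n sigma _.
  have pfin : p \is a fin_num by apply: fin_num_measure; apply: measurable_enorm_le;
    [exact: ltW|exact: measurable_row_sub].
  have mse_lt : (mean_squared_error sigma M (t *m U)
      < (5^-1 * eps ^+ 2)%:E)%E.
    apply: le_lt_trans risk_lt; apply: ereal_sup_ubound.
    by exists (t *m U) => //; exact: TX.
  have s0 : 0 < 5 ^+ k :> R by rewrite exprn_gt0.
  (* The choice s = 5^k beats the second moment 4^k of the likelihood ratio. *)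
  have := @mean_squared_error_lower R n sigma M (t *m U) eps _ sigma0 mM
    (ltW eps0) s0.
  rewrite -/p -(fineK pfin) => lower.
  have : ((eps ^+ 2)%:E < (5^-1 * eps ^+ 2)%:E + (eps ^+ 2 / 2)%:E *
      ((5 ^+ k)%:E * (fine p)%:E
       + ((5 ^+ k)^-1 * expR (enorm (t *m U) ^+ 2 / sigma ^+ 2))%:E))%E.
    by apply: le_lt_trans lower _; rewrite lteD2rE.
  rewrite -!EFinM -!EFinD lte_fin lee_fin enorm_isometry//.
  have expo : expR (enorm t ^+ 2 / sigma ^+ 2) <= 4 ^+ k.
    apply: le_trans (expR_natr_le k); rewrite ler_expR ler_pdivrMr ?exprn_gt0//.
    apply: le_trans rk; rewrite lerXn2r ?nnegrE ?enorm_ge0 ?(ltW r0)//.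
    exact: Tr.
  have expo5 : (5 ^+ k)^-1 * expR (enorm t ^+ 2 / sigma ^+ 2) <= 4 / 5.
    apply: le_trans q1; rewrite mulrC expr_div_n ler_pM2r ?invr_gt0//.
  rewrite ler_pdivrMr// [fine p * _]mulrC.
  have e20 : 0 < eps ^+ 2 by rewrite exprn_gt0.
  move: expo5; set y := _^-1 * _; set z := 5 ^+ k * _ => y45.
  have -> : 5^-1 * eps ^+ 2 + eps ^+ 2 / 2 * (z + y) =
    eps ^+ 2 * (5^-1 + (z + y) / 2) by field.
  by rewrite -{1}[eps ^+ 2]mulr1 ltr_pM2l// => ?; lra.
have a0 : 0 <= 4 / 5 / 5 ^+ k :> R by rewrite !divr_ge0// exprn_ge0.
have := @volume_mean_hitting R k n sigma U M T eps _ UU mM mT (ltW eps0) a0 hit.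
apply/negP; rewrite -ltNge volume_eball_scale ?(ltW r0)//.
have -> : d ^+ k = (3 / 20) ^+ k * c ^+ k by rewrite -exprMn.
rewrite EFinM -muleA.
apply: (@le_lt_trans _ _ (((3 / 20) ^+ k)%:E * volume R k T)%E).
  by apply: lee_wpmul2l => //; rewrite lee_fin exprn_ge0//; lra.
have Tfin_num : volume R k T \is a fin_num by rewrite ge0_fin_numE.
rewrite -(fineK Tfin_num) -!EFinM lte_fin ltr_pM2r ?fine_gt0 ?T0//.
(* The constant 3/20 in eps makes this strict even for k = 1: 3/20 < 4/25. *)
apply: (@lt_le_trans _ _ ((4 / 5) ^+ k / 5 ^+ k)); last first.
  by rewrite ler_pM2r ?invr_gt0 ?exprn_gt0.
by rewrite -expr_div_n ltrXn2r -?lt0n//; lra.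
Qed.

End minimax_lower_bound.

(** * From volume ratios to the minimax risk *)

Section reduction.
Variable R : realType.

Lemma orthonormal_basis_get (n k : nat) (H : {vspace 'rV[R]_n}) :
  \dim H = k ->
  let U := xget 0 (orthonormal_basis H : set 'M[R]_(k, n)) in
  U *m U^T = 1%:M /\ (forall t, t *m U \in H).
Proof.
move=> dimH U.
have [UU UH] : (orthonormal_basis H : set 'M[R]_(k, n)) U.
  by apply: xgetPex; exact: exists_orthonormal_basis.
by split => // t; have : [set x | x \in H] (t *m U) by rewrite -UH; exists t.
Qed.

(** A set of positive volume ratio is turned into a measurable set of
coordinates. The volume of the ball cannot vanish, for the ratio would then
be 0 by the convention on division and not exceed c. *)
Lemma volume_ratio_gt (n k : nat) (H : {vspace 'rV[R]_n}) (X : set 'rV[R]_n)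
    (c r : R) :
  (0 < k)%N -> compact X -> \dim H = k -> 0 < r -> 0 < c ->
  c < volume_ratio k H X r ->
  exists U : 'M[R]_(k, n), U *m U^T = 1%:M /\
    let A := [set t : 'rV[R]_k | X (t *m U) /\ enorm t <= r] in
    [/\ measurable A, (0 < volume R k A)%E &
     ((c ^+ k)%:E * volume R k (eball k r) <= volume R k A)%E].
Proof.
move=> k0 cX dimH r0 c0; rewrite /volume_ratio /subspace_volume.
have [] := orthonormal_basis_get _ _ _ dimH.
set U := xget _ _ => UU UH cr; exists U; split => //=; set A := [set t | _].
have AE : [set t | (X `&` [set x | x \in H] `&` eball n r) (t *m U)] = A.
  apply/seteqP; split => t; rewrite /eball/= enorm_isometry//.
    by move=> [[Xt _] tr].
  by move=> [Xt tr]; split => //; split => //; exact: UH.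
rewrite AE in cr.
have mA : measurable A.
  have -> : A = ((fun t => t *m U) @^-1` X) `&` eball k r by [].
  apply: measurableI; last exact: measurable_eball (ltW r0).
  rewrite -[X in measurable X]setTI; apply: measurable_mulmx => //.
  exact: compact_measurable_row.
have Bfin : volume R k (eball k r) \is a fin_num.
  by rewrite ge0_fin_numE// volume_eball_lty ?ltW.
have Afin : volume R k A \is a fin_num.
  rewrite ge0_fin_numE//; apply: le_lt_trans (volume_eball_lty R k r (ltW r0)).
  apply: le_measure; rewrite ?inE//; first exact: measurable_eball (ltW r0).
  by move=> t [].
set a := fine _ in cr; set b := fine _ in cr.
have a0 : 0 <= a by exact: fine_ge0.
have b0 : 0 <= b by exact: fine_ge0.
have ck : c ^+ k < a / b.
  have -> : a / b = ((a / b) `^ k%:R^-1) ^+ k.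
    rewrite -powR_mulrn ?powR_ge0// -powRrM mulVf ?powRr1 ?divr_ge0//.
    by rewrite pnatr_eq0 -lt0n.
  by rewrite ltrXn2r -?lt0n// ?(ltW c0).
have b_gt0 : 0 < b.
  rewrite lt_neqAle b0 andbT; apply: contraTN ck => /eqP <-.
  by rewrite invr0 mulr0 -leNgt exprn_ge0// ltW.
have ab : c ^+ k * b < a by rewrite -ltr_pdivlMr.
split => //.
- by rewrite -(fineK Afin) lte_fin (le_lt_trans _ ab)// mulr_ge0// exprn_ge0// ltW.
- by rewrite -(fineK Afin) -(fineK Bfin) -EFinM lee_fin ltW.
Qed.

Lemma minimax_risk_ge0 (n : nat) (X : set 'rV[R]_n) (sigma : R) :
  X 0 -> (0 <= minimax_risk X sigma)%E.
Proof.
move=> X0; apply: le_ereal_inf_tmp => _ [M mM <-].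
apply: (@le_trans _ _ (mean_squared_error sigma M 0)).
  rewrite /mean_squared_error unlock; apply: integral_ge0 => w _.
  by rewrite lee_fin sqr_ge0.
by apply: ereal_sup_ubound; exists 0.
Qed.

(** Shrinking the slice from radius r1 to rho scales its volume and that of
the ball by the same factor, so the volume ratio hypothesis at r1 serves at
every smaller radius. *)
Lemma volume_ratio_minimax_lower (n k : nat) (H : {vspace 'rV[R]_n})
    (X : set 'rV[R]_n) (sigma c r1 rho : R) :
  (0 < k)%N -> compact X ->
  convex_set (X : set (convex_lmodType 'rV[R]_n)) -> X 0 ->
  0 < sigma -> \dim H = k -> 0 < r1 -> 0 < c ->
  c < volume_ratio k H X r1 ->
  0 < rho -> rho <= r1 -> rho ^+ 2 <= k%:R * sigma ^+ 2 ->
  ((5^-1 * (3 / 20 * c * rho) ^+ 2)%:E <= minimax_risk X sigma)%E.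
Proof.
move=> k0 cX convX X0 sigma0 dimH r10 c0 cr rho0 rho_r1 rho_k.
have [U [UU /=]] := volume_ratio_gt _ _ _ _ _ _ k0 cX dimH r10 c0 cr.
set A := [set t | _] => -[mA A0 Ac].
pose l := rho / r1.
have l0 : 0 < l by rewrite divr_gt0.
have li0 : 0 < l^-1 by rewrite invr_gt0.
have l1 : l <= 1 by rewrite ler_pdivrMr// mul1r.
have lr1 : l * r1 = rho by rewrite /l divfK// gt_eqF.
pose T := [set t : 'rV[R]_k | A (l^-1 *: t + 0)].
have mT : measurable T.
  have m1 := measurable_row_affine R k l^-1 0 measurableT _ mA.
  by rewrite setTI in m1.
have volT : volume R k T = ((l ^+ k)%:E * volume R k A)%E.
  by rewrite /T volume_affine// invrK.
apply: (@slice_minimax_lower R k n X sigma c rho U T) => //.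
- move=> t [Xt _]; rewrite addr0 in Xt.
  have /set_mem Xconv := convX (l^-1 *: t *m U) 0 (Itv01 (ltW l0) l1)
    (mem_set Xt) (mem_set X0).
  have -> : t *m U = l *: (l^-1 *: t *m U) + (1 - l) *: 0.
    by rewrite scaler0 addr0 -scalemxAl scalerA divff ?gt_eqF// scale1r.
  exact: Xconv.
- move=> t [_]; rewrite addr0 enormZ ?(ltW li0)//.
  by rewrite ler_pdivrMl// lr1.
- by rewrite volT mule_gt0// lte_fin exprn_gt0.
- rewrite volT -lr1 volume_eball_scale// ?(ltW r10)// muleCA.
  by apply: lee_wpmul2l => //; rewrite lee_fin exprn_ge0// ltW.
Qed.

(** Replacing c and the radius by their halves gives strict inequalities, so
that a radius and a subspace witnessing the two suprema can be extracted; this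
also covers an infinite approximation radius. *)
Lemma approx_radius_minimax_lower (n k : nat) (X : set 'rV[R]_n)
    (sigma c : R) :
  (0 < k)%N -> compact X ->
  convex_set (X : set (convex_lmodType 'rV[R]_n)) -> X 0 ->
  0 < sigma -> 0 < c ->
  ((246 / 10 ^+ 6 * c ^+ 2)%:E *
     mine (approx_radius c k X ^+ 2) (k%:R * sigma ^+ 2)%:E
   <= minimax_risk X sigma)%E.
Proof.
move=> k0 cX convX X0 sigma0 c0; set z := approx_radius _ _ _.
set m := mine _ _.
have z0 : (0 <= z)%E by rewrite /z /approx_radius le_max lexx.
have ks : 0 < k%:R * sigma ^+ 2 by rewrite mulr_gt0 ?exprn_gt0// ltr0n.
have C0 : 0 < 246 / 10 ^+ 6 * c ^+ 2.
  by rewrite mulr_gt0 ?divr_gt0 ?exprn_gt0.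
have m0 : (0 <= m)%E by rewrite le_min expe_ge0//= lee_fin ltW.
have mk : (m <= (k%:R * sigma ^+ 2)%:E)%E by rewrite ge_min lexx orbT.
have mz : (m <= z ^+ 2)%E by rewrite ge_min lexx.
have mfin : m \is a fin_num by rewrite ge0_fin_numE// (le_lt_trans mk)// ltry.
move: m0 mk mz; rewrite -(fineK mfin); move: (fine m) => {m mfin} m.
rewrite !lee_fin le_eqVlt => /predU1P[<- _ _|m0 mk mz].
  by rewrite mule0; exact: minimax_risk_ge0.
pose rho := Num.sqrt m.
have rho0 : 0 < rho by rewrite sqrtr_gt0.
have rho2 : rho ^+ 2 = m by rewrite sqr_sqrtr// ltW.
have rhoz : (rho%:E <= z)%E.
  rewrite leNgt; apply/negP => zr; move: mz; apply/negP; rewrite -ltNge.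
  have zfin : z \is a fin_num by rewrite ge0_fin_numE// (lt_trans zr)// ltry.
  rewrite -(fineK zfin) -EFin_expe lte_fin -rho2.
  rewrite ltrXn2r// ?fine_ge0//.
  by rewrite -lte_fin fineK.
have : ((rho / 2)%:E < z)%E.
  by apply: lt_le_trans rhoz; rewrite lte_fin ltr_pdivrMr// ltr_pMr// ltr1n.
rewrite /z /approx_radius lt_max => /orP[|].
  by rewrite lte_fin ltNge divr_ge0// ltW.
move=> /ereal_sup_gt[_ [r1 [r10 cr1] <-]]; rewrite lte_fin => rho_r1.
have : ((c / 2)%:E < max_volume_ratio k X r1)%E.
  by apply: lt_le_trans cr1; rewrite lte_fin ltr_pdivrMr// ltr_pMr// ltr1n.
move=> /ereal_sup_gt[_ [H dimH <-]]; rewrite lte_fin => cH.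
have c20 : 0 < c / 2 by rewrite divr_gt0.
have rho20 : 0 < rho / 2 by rewrite divr_gt0.
apply: le_trans (volume_ratio_minimax_lower n k H X sigma (c / 2) r1 (rho / 2)
  k0 cX convX X0 sigma0 dimH r10 c20 cH rho20 (ltW rho_r1) _).
  rewrite -EFinM lee_fin -rho2.
  have -> : 5^-1 * (3 / 20 * (c / 2) * (rho / 2)) ^+ 2 =
    9 / 32 / 10 ^+ 3 * (c ^+ 2 * rho ^+ 2).
    have -> : 20 = 2 * 10 :> R by rewrite -natrM.
    have -> : 5 = 10 / 2 :> R by lra.
    have : 10 != 0 :> R by rewrite pnatr_eq0.
    by move: (10 : R) => x x0; field.
  rewrite -(mulrA _ (c ^+ 2)); apply: ler_wpM2r; first by rewrite mulr_ge0// sqr_ge0.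
  rewrite (exprD _ 3 3) invfM mulrA ler_pM2r ?invr_gt0 ?exprn_gt0//.
  rewrite ler_pdivrMr ?exprn_gt0//.
  have -> : 10 ^+ 3 = 1000 :> R by rewrite -natrX.
  lra.
apply: le_trans mk; rewrite -rho2 lerXn2r ?nnegrE ?(ltW rho0) ?(ltW rho20)//.
by rewrite ler_pdivrMr// ler_pMr// ler1n.
Qed.

End reduction.

Theorem theorem3p2 (R : realType) (n : nat) (X : set 'rV[R]_n) (sigma c : R)
    (n_ge1 : (1 <= n)%N)
    (X_compact : compact X)
    (X_convex : convex_set (X : set (convex_lmodType 'rV[R]_n)))
    (X_body : interior X !=set0)
    (X_origin : X 0)
    (sigma_gt0 : 0 < sigma)
    (c_gt0 : 0 < c) (c_le1 : c <= 1) :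
  ((246 / 10 ^+ 6 * c ^+ 2)%:E *
     \big[maxe/-oo]_(1 <= k < n.+1)
        mine (approx_radius c k X ^+ 2) (k%:R * sigma ^+ 2)%:E
   <= minimax_risk X sigma)%E.
Proof.
have C0 : 0 < 246 / 10 ^+ 6 * c ^+ 2 by rewrite mulr_gt0 ?divr_gt0 ?exprn_gt0.
rewrite big_nat; elim/big_rec : _ => [|k y /andP[k1 _] IH].
  by rewrite gt0_muleNy ?lte_fin// leNye.
rewrite maxEle; case: ifP => _ //.
exact: approx_radius_minimax_lower.
Qed.
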